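(* Let $\mathcal{N}$ be a complete homogeneous network with asymmetric input and with $t$ types of arrow. There exist a class $\mathfrak{C}_{\mathcal{N}}$ of complete homogeneous networks with asymmetric input, an integer $k\ge 1$, integers $n_1,\dots,n_k\ge 1$, and formal linear maps $$\Lambda^l_{i,j}(x_1,\dots,x_t)=\sum_{s=1}^t a^{l,s}_{i,j}\,x_s ,\qquad a^{l,s}_{i,j}\in\mathbb{C},\quad l\in\{1,\dots,k\},\ i,j\in\{1,\dots,n_l\},$$ such that the following holds. 1. $\mathfrak{C}_{\mathcal{N}}$ contains $\mathcal{N}$ and is closed under taking subnetworks, quotient networks and disjoint unions. Moreover, every network in $\mathfrak{C}_{\mathcal{N}}$ has the same arrow types as $\mathcal{N}$ (so that a single response function describes admissible maps for all networks in $\mathfrak{C}_{\mathcal{N}}$ simultaneously). 2. The linear maps $\Lambda^l_{i,j}$, for $l\in\{1,\dots,k\}$ and $i,j\in\{1,\dots,n_l\}$, are all linearly independent. In particular $n_1^2+n_2^2+\dots+n_k^2\le t$. 3. $n_1=1$ and $\Lambda^1_{1,1}(x_1,\dots,x_t)=x_1+x_2+\dots+x_t$. 4. For every network $\mathcal{M}\in\mathfrak{C}_{\mathcal{N}}$ there exist non-negative integers $m^{\mathcal{M}}_1,\dots,m^{\mathcal{M}}_k$ such that for every finite dimensional complex vector space $V$ and every linear response function $f:V^t\to V$, $f(X_1,\dots,X_t)=\sum_{s=1}^t C_sX_s$ with $C_s:V\to V$ linear, we have $$M_\lambda(\gamma^{\mathcal{M}}_f)=\sum_{l=1}^k m^{\mathcal{M}}_l\,M_\lambda\big(\Lambda^l(C_1,\dots,C_t)\big)\qquad\text{for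 all }\lambda\in\mathbb{C}.$$ Here $\Lambda^l(C_1,\dots,C_t)$ is the $n_l\times n_l$ block matrix with $(i,j)$ block $\Lambda^l_{i,j}(C_1,\dots,C_t)=\sum_{s}a^{l,s}_{i,j}C_s$. (In words: the eigenvalues of $\gamma^{\mathcal{M}}_f$ are those of $\Lambda^1(C_1,\dots,C_t)$, $m^{\mathcal{M}}_1$ times, together with those of $\Lambda^2(C_1,\dots,C_t)$, $m^{\mathcal{M}}_2$ times, up to those of $\Lambda^k(C_1,\dots,C_t)$, $m^{\mathcal{M}}_k$ times.) The multiplicities $m^{\mathcal{M}}_l$ are determined by the trace of $\gamma^{\mathcal{M}}_f$, through the identity $\operatorname{tr}(\gamma^{\mathcal{M}}_f)=\sum_{l=1}^k m^{\mathcal{M}}_l\operatorname{tr}(\Lambda^l(C_1,\dots,C_t))$ and the linear independence of the maps $\Lambda^l_{i,j}$. 5. For any network $\mathcal{M}\in\mathfrak{C}_{\mathcal{N}}$ with $M>0$ nodes we have $\sum_{l=1}^k m^{\mathcal{M}}_l n_l=M$ and $m^{\mathcal{M}}_1\ge 1$. Moreover, if $\mathcal{P}$ is a quotient network of $\mathcal{M}$, then $m^{\mathcal{P}}_l\le m^{\mathcal{M}}_l$ for all $l\in\{1,\dots,k\}$.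
   Context: A homogeneous network with asymmetric input and with $t$ types of arrow consists of a finite set $N$ of nodes together with input maps $\sigma_1,\dots,\sigma_t:N\to N$, one for each arrow type; $\sigma_s(p)$ is the source of the unique arrow of type $s$ whose target is $p$. Different arrow types are allowed to define the same input map. The network is complete if some arrow type has the identity as its input map (all self-loops), and for every ordered pair of arrow types $(c,d)$ there is an arrow type $e$ with $\sigma_d\circ\sigma_c=\sigma_e$ (tracing an arrow of type $c$ back to its source and then an arrow of type $d$ back to its source amounts to tracing an arrow of type $e$ back). Networks with the same arrow types are networks whose input maps are indexed by the same set. For such networks: a subnetwork is given by a subset of nodes that is mapped to itself by all input maps, with the restricted input maps; a graph fibration is a map $F$ between the node sets with $F\circ\sigma_s=\sigma_s\circ F$ for every arrow type $s$ (with $\sigma_s$ denoting the respective input maps); a network $\mathcal{P}$ is a quotient network of $\mathcal{M}$ if there is a surjective graph fibration from $\mathcal{M}$ to $\mathcal{P}$; the disjoint union has as node set the disjoint union of the node sets, with the evident input maps. Given a network $\mathcal{M}$ with node set $N$ and input maps $\sigma_1,\dots,\sigma_t$, a vector space $V$ and a response function $f:V^t\to V$, the admissible map $\gamma^{\mathcal{M}}_f:V^N\to V^N$ is $(\gamma^{\mathcal{M}}_f(x))_p=f(x_{\sigma_1(p)},\dots,x_{\sigma_t(p)})$ for $p\in N$. For a linear map $X$ of a finite dimensional complex vector space, $M_\lambda(X)$ denotes the algebraic multiplicity of $\lambda\in\mathbb{C}$ as an eigenvalue of $X$, with $M_\lambda(X)=0$ if $\lambda$ is not an eigenvalue. *)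

(* Defs.v *)
From HB Require Import structures.
From mathcomp Require Import all_boot all_order all_algebra.

Set Implicit Arguments.
Unset Strict Implicit.
Unset Printing Implicit Defensive.

Import GRing.Theory.
Local Open Scope ring_scope.

(* [inp M s p] is the source of the unique arrow of type [s] with target [p].
   The node set may be empty. *)
Record network (t : nat) := Network {
  node :> finType;
  inp : 'I_t -> node -> node
}.

Section Networks.
Variable t : nat.
Implicit Types M P : network t.

Definition complete M :=
  (exists s, inp (n := M) s =1 id) /\
  (forall c d : 'I_t, exists e : 'I_t,
     inp (n := M) d \o inp (n := M) c =1 inp (n := M) e).

Definition fibration M P (F : M -> P) :=
  forall s p, F (inp s p) = inp s (F p).

Definition quotient_of P M :=
  exists2 F : M -> P, fibration F & forall q, exists p, F p = q.

Definition stable M (A : {set M}) := forall s p, p \in A -> inp s p \in A.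

Definition subnetwork M (A : {set M}) (stA : stable A) : network t :=
  @Network t {p : M | p \in A}
    (fun s u => exist _ (inp s (val u)) (stA s _ (valP u))).

Definition disjoint_union M P : network t :=
  @Network t (M + P)%type
    (fun s u => match u with
                | inl p => inl (inp s p)
                | inr q => inr (inp s q)
                end).

Definition admissible M (V : Type) (f : {ffun 'I_t -> V} -> V)
    (x : {ffun M -> V}) : {ffun M -> V} :=
  [ffun p => f [ffun s => x (inp s p)]].

End Networks.

Section LinearMaps.
Variable K : fieldType.

Fact admissible_is_linear t (M : network t) (V : vectType K)
    (f : 'Hom({ffun 'I_t -> V}, V)) : linear (@admissible t M V f).
Proof.
move=> a x y; apply/ffunP => p; rewrite !ffunE -linearP; congr (f _).
by apply/ffunP => s; rewrite !ffunE.
Qed.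

HB.instance Definition _ t (M : network t) (V : vectType K)
    (f : 'Hom({ffun 'I_t -> V}, V)) :=
  GRing.isLinear.Build K {ffun M -> V} {ffun M -> V} _ (@admissible t M V f)
    (admissible_is_linear f).

Definition admissible_lin t (M : network t) (V : vectType K)
    (f : 'Hom({ffun 'I_t -> V}, V)) : 'End({ffun M -> V}) :=
  linfun (@admissible t M V f).

(* The formal linear map a_1 x_1 + ... + a_t x_t is encoded by the row vector
   (a_1, ..., a_t); here it is evaluated at vectors (in particular
   endomorphisms) x_1, ..., x_t. *)
Definition eval_formal t (L : 'rV[K]_t) (E : lmodType K) (x : 'I_t -> E) : E :=
  \sum_s L 0 s *: x s.

Definition block n (V : vectType K) (B : 'I_n -> 'I_n -> 'End(V))
    (x : {ffun 'I_n -> V}) : {ffun 'I_n -> V} :=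
  [ffun i => \sum_j B i j (x j)].

Fact block_is_linear n (V : vectType K) (B : 'I_n -> 'I_n -> 'End(V)) :
  linear (block B).
Proof.
move=> a x y; apply/ffunP => i; rewrite !ffunE scaler_sumr -big_split /=.
by apply: eq_bigr => j _; rewrite !ffunE linearP.
Qed.

HB.instance Definition _ n (V : vectType K) (B : 'I_n -> 'I_n -> 'End(V)) :=
  GRing.isLinear.Build K {ffun 'I_n -> V} {ffun 'I_n -> V} _ (block B)
    (block_is_linear B).

Definition block_lin n (V : vectType K) (B : 'I_n -> 'I_n -> 'End(V)) :
  'End({ffun 'I_n -> V}) := linfun (block B).

Definition eval_block t n (L : 'I_n -> 'I_n -> 'rV[K]_t) (V : vectType K)
    (C : 'I_t -> 'End(V)) : 'End({ffun 'I_n -> V}) :=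
  block_lin (fun i j => eval_formal (L i j) C).

(* [mxof] acts on row vectors, so this is the transpose of the usual matrix of
   X, with the same trace and characteristic polynomial. *)
Definition mx_of_end (W : vectType K) (X : 'End(W)) :=
  passmx.mxof (vbasis {:W}) (vbasis {:W}) X.

Definition alg_mult (W : vectType K) (lambda : K) (X : 'End(W)) : nat :=
  mup lambda (char_poly (mx_of_end X)).

Definition end_trace (W : vectType K) (X : 'End(W)) : K := \tr (mx_of_end X).

End LinearMaps.

(* Main.v *)
Require Import Defs.
From HB Require Import structures.
From mathcomp Require Import all_boot all_order all_algebra.
From mathcomp Require Import boolp.
From mathcomp Require Import reals.
From mathcomp.real_closed Require Import complex.

Set Implicit Arguments.
Unset Strict Implicit.
Unset Printing Implicit Defensive.

Import GRing.Theory Num.Theory.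
Local Open Scope ring_scope.

(** A product of arrow types chosen in [N] turns the arrow types into a set with
    a distinguished element [one] and a binary operation [mul], and the input
    maps of [N] obey [sigma_one = id] and
    [sigma_d \o sigma_c = sigma_(mul c d)].  The class consists of all networks
    whose input maps obey these same identities; identities pass to
    subnetworks, quotients and disjoint unions.

    For a network [M] of the class, pulling functions on [M] back along the
    input maps gives matrices [P_s] with [P_one = 1] and
    [P_(mul c d) = P_c P_d], that is, a representation of [(one, mul)].  The
    admissible map with linear response [C] is the operator
    [\sum_s P_s (x) C_s] ([admissible_rep_block]).  In a basis adapted to a
    composition series, all the [P_s] are block triangular simultaneously, with
    irreducible diagonal blocks; so the characteristic polynomial of
    [\sum_s P_s (x) C_s] is the product of those of [\sum_s S_l(s) (x) C_s],
    where [S_l] runs over the irreducible representations, with their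
    multiplicities as composition factors of [P] ([constituents_exist]).  Hence
    [Lam l i j] is the matrix coefficient [s |-> S_l(s)_{ij}], and the
    multiplicities of [M] are those composition multiplicities.

    The linear independence of the [Lam l i j] is the Frobenius-Schur theorem on
    the matrix coefficients of pairwise non-isomorphic irreducible
    representations over an algebraically closed field ([matrix_coef_indep]).
    It also shows that there are at most [t] irreducible representations, so
    that a complete list exists ([complete_family]), and that the multiplicities
    are determined by traces ([character_inj]).  Being unique, they are additive
    along extensions: a surjective fibration embeds the functions on [P]
    into the functions on [M], which compares multiplicities
    ([network_quotient_le]), and the constant functions contribute one copy of
    the trivial representation ([network_triv]). *)

(** * Biproducts, and endomorphisms that respect a short exact sequence *)

Section Biproduct.
Variable K : fieldType.

(** On row vectors, [G] and [H'] are the inclusions and [G'] and [H] the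
    projections of a decomposition of the space of dimension [w] as a direct
    sum.  Carrying all four maps makes every fact about subspaces and quotients
    an identity between matrices, which any additive functor preserves. *)
Definition biproduct w u u' (G : 'M[K]_(u, w)) (G' : 'M_(w, u))
    (H : 'M_(w, u')) (H' : 'M_(u', w)) :=
  [/\ G *m G' = 1%:M, H' *m H = 1%:M, G *m H = 0 & G' *m G + H *m H' = 1%:M].

Lemma biproduct_cross w u u' (G : 'M[K]_(u, w)) (G' : 'M_(w, u))
    (H : 'M_(w, u')) (H' : 'M_(u', w)) :
  biproduct G G' H H' -> H' *m G' = 0.
Proof.
case=> GG HH GH E; have /(congr1 (fun M => M *m G')) : H' *m G' *m G = 0.
  apply: (addIr (H' *m H *m H')); rewrite add0r -!mulmxA -mulmxDr E mulmx1.
  by rewrite mulmxA HH mul1mx.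
by rewrite mul0mx -mulmxA GG mulmx1.
Qed.

Lemma biproduct_dim w u u' (G : 'M[K]_(u, w)) (G' : 'M_(w, u))
    (H : 'M_(w, u')) (H' : 'M_(u', w)) :
  biproduct G G' H H' -> w = (u + u')%N.
Proof.
move=> bip; have HG := biproduct_cross bip; case: bip => GG HH GH E.
apply/eqP; rewrite eqn_leq; apply/andP; split.
  apply: (@mulmx1_min _ _ _ (row_mx G' H) (col_mx G H')).
  by rewrite mul_row_col.
apply: (@mulmx1_min _ _ _ (col_mx G H') (row_mx G' H)).
by rewrite mul_col_row GG GH HG HH -scalar_mx_block.
Qed.

Lemma char_poly_trace_conj n (T T' X : 'M[K]_n) : T *m T' = 1%:M ->
  char_poly (T *m X *m T') = char_poly X /\ \tr (T *m X *m T') = \tr X.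
Proof.
move=> TT; have T'T := mulmx1C TT.
split; last by rewrite mxtrace_mulC mulmxA T'T mul1mx.
have -> : char_poly (T *m X *m T') =
    \det (map_mx polyC T *m char_poly_mx X *m map_mx polyC T').
  rewrite /char_poly /char_poly_mx; congr (\det _).
  rewrite mulmxBr mulmxBl -!map_mxM; congr (_ - _).
  by rewrite scalar_mxC -mulmxA -map_mxM TT map_mx1 mulmx1.
by rewrite !det_mulmx mulrAC -det_mulmx -map_mxM TT map_mx1 det1 mul1r.
Qed.

(** In the basis adapted to the decomposition, an endomorphism that maps the
    summand [G] into itself is block triangular. *)
Lemma char_poly_trace_biproduct w u u' (G : 'M[K]_(u, w)) (G' : 'M_(w, u))
    (H : 'M_(w, u')) (H' : 'M_(u', w)) (X : 'M_w) :
  biproduct G G' H H' -> G *m X *m H = 0 ->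
  char_poly X = char_poly (G *m X *m G') * char_poly (H' *m X *m H) /\
  \tr X = \tr (G *m X *m G') + \tr (H' *m X *m H).
Proof.
move=> bip; have ew := biproduct_dim bip; have HG := biproduct_cross bip.
case: bip; subst w => GG HH GH E GXH.
have TT : col_mx G H' *m row_mx G' H = 1%:M.
  by rewrite mul_col_row GG GH HG HH -scalar_mx_block.
have [<- <-] := char_poly_trace_conj X TT.
rewrite mul_col_mx mul_col_row GXH mxtrace_block; split=> //.
rewrite /char_poly /char_poly_mx (map_block_mx polyC) map_mx0.
by rewrite (scalar_mx_block _ _ 'X) opp_block_mx add_block_mx subr0 det_lblock.
Qed.

(** A complement comes from splitting the idempotent [1 - G' G], where [G'] is
    any right inverse of [G], through its image. *)
Lemma biproduct_left w u (G : 'M[K]_(u, w)) : row_free G ->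
  exists G' u' (H : 'M_(w, u')) H', biproduct G G' H H'.
Proof.
move=> fG; set E := 1%:M - pinvmx G *m G.
have GG := mulmxVp fG.
have GE : G *m E = 0 by rewrite mulmxBr mulmx1 mulmxA GG mul1mx subrr.
have EE : E *m E = E by rewrite {1}/E mulmxBl mul1mx -mulmxA GE mulmx0 subr0.
have fc : row_full (col_base E) by exact: col_base_full.
have fr : row_free (row_base E) by exact: row_base_free.
exists (pinvmx G), _, (col_base E), (row_base E); split=> //.
- apply: (row_free_inj fr); rewrite mul1mx.
  apply: (row_full_inj fc).
  by rewrite /= -mulmxA mulmx_base mulmxA mulmx_base EE.
- by apply: (row_free_inj fr); rewrite -mulmxA mulmx_base GE mul0mx.
- by rewrite mulmx_base addrC subrK.
Qed.

Lemma biproduct_right w u' (H : 'M[K]_(w, u')) (H' : 'M_(u', w)) :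
  H' *m H = 1%:M -> exists u (G : 'M_(u, w)) G', biproduct G G' H H'.
Proof.
move=> HH; set E := 1%:M - H *m H'.
have EH : E *m H = 0 by rewrite mulmxBl mul1mx -mulmxA HH mulmx1 subrr.
have EE : E *m E = E by rewrite {2}/E mulmxBr mulmx1 mulmxA EH mul0mx subr0.
have fc : row_full (col_base E) by exact: col_base_full.
have fr : row_free (row_base E) by exact: row_base_free.
exists _, (row_base E), (col_base E); split=> //.
- apply: (row_free_inj fr); rewrite mul1mx.
  apply: (row_full_inj fc).
  by rewrite /= -mulmxA mulmx_base mulmxA mulmx_base EE.
- by apply: (row_full_inj fc); rewrite mulmxA mulmx_base EH mulmx0.
- by rewrite mulmx_base subrK.
Qed.

End Biproduct.

Section EndBiproduct.
Variables (K : fieldType) (W U U' : vectType K).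
Variables (i : 'Hom(U, W)) (p : 'Hom(W, U)) (j : 'Hom(U', W)) (q : 'Hom(W, U')).
Hypotheses (pi : (p \o i = \1)%VF) (qj : (q \o j = \1)%VF).
Hypotheses (pj : (p \o j)%VF = 0) (ipjq : (i \o p)%VF + (j \o q)%VF = \1%VF).

Lemma char_poly_trace_End (X : 'End(W)) : (p \o (X \o j))%VF = 0 ->
  char_poly (mx_of_end X) =
    char_poly (mx_of_end (p \o (X \o i))%VF) *
    char_poly (mx_of_end (q \o (X \o j))%VF) /\
  end_trace X = end_trace (p \o (X \o i))%VF + end_trace (q \o (X \o j))%VF.
Proof.
pose mx (A B : vectType K) (f : 'Hom(A, B)) :=
  passmx.mxof (vbasis {:A}) (vbasis {:B}) f.
have mxM (A B C : vectType K) (f : 'Hom(A, B)) (g : 'Hom(B, C)) :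
    mx _ _ f *m mx _ _ g = mx _ _ (g \o f)%VF.
  by rewrite /mx (passmx.mxof_comp _ _ (vbasisP {:B})).
have mx1 (A : vectType K) : mx A A \1%VF = 1%:M.
  exact: passmx.mxof1 (basis_free (vbasisP _)).
have mx0 (A B : vectType K) : mx A B 0 = 0.
  by apply/eqP; rewrite passmx.mxof_eq0 ?vbasisP.
have mxD (A B : vectType K) (f g : 'Hom(A, B)) :
    mx A B (f + g) = mx A B f + mx A B g.
  have := passmx.mxof_linear (vbasis {:A}) (vbasis {:B}) 1 f g.
  by rewrite !scale1r.
move=> pXj.
(* Matrices act on row vectors, so composition is reversed and the inclusion
   [j] takes the place of the stable summand. *)
have bip : biproduct (mx _ _ j) (mx _ _ q) (mx _ _ p) (mx _ _ i).
  split; rewrite ?mxM ?pi ?qj ?mx1 //; first by rewrite pj mx0.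
  by rewrite -mxD addrC ipjq mx1.
have [|cX tX] := @char_poly_trace_biproduct _ _ _ _ _ _ _ _ (mx _ _ X) bip.
  by rewrite !mxM pXj mx0.
rewrite /end_trace /mx_of_end -/(mx _ _ X) cX tX !mxM.
by split; [rewrite mulrC|rewrite addrC].
Qed.

End EndBiproduct.

Lemma char_poly_trace_dim0 (K : fieldType) (W : vectType K) (X : 'End(W)) :
  \dim {:W} = 0%N -> char_poly (mx_of_end X) = 1 /\ end_trace X = 0.
Proof.
rewrite /end_trace; move: (mx_of_end X); move: (\dim _) => d M d0.
by subst d; rewrite /char_poly det_mx00 /mxtrace big_ord0.
Qed.

Lemma char_poly_trace_End_iso (K : fieldType) (W U : vectType K)
    (i : 'Hom(U, W)) (p : 'Hom(W, U)) (X : 'End(W)) :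
  (p \o i = \1)%VF -> (i \o p = \1)%VF ->
  char_poly (mx_of_end (p \o (X \o i))%VF) = char_poly (mx_of_end X) /\
  end_trace (p \o (X \o i))%VF = end_trace X.
Proof.
move=> pi ip; pose j : 'Hom('rV[K]_0, W) := 0; pose q : 'Hom(W, 'rV[K]_0) := 0.
have qj : (q \o j = \1)%VF.
  by apply/lfunP => x; rewrite [LHS]thinmx0 [RHS]thinmx0.
have dim0 : \dim {:'rV[K]_0} = 0%N by rewrite dimvf dim_matrix.
have pj : (p \o j)%VF = 0 by rewrite comp_lfun0r.
have ipjq : (i \o p)%VF + (j \o q)%VF = \1%VF by rewrite comp_lfun0r addr0.
have [|-> ->] := char_poly_trace_End pi qj pj ipjq (X := X).
  by rewrite !comp_lfun0r.
have [-> ->] := char_poly_trace_dim0 (q \o (X \o j))%VF dim0.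
by rewrite mulr1 addr0.
Qed.

(** The rank one endomorphisms [w |-> c_i(w) e_i] sum to the identity, and the
    trace of [X] composed with one of them is [c_i (X e_i)]. *)
Lemma end_trace_frame (K : fieldType) (W : vectType K) (I : finType)
    (e : I -> W) (c : I -> {scalar W}) (X : 'End(W)) :
  (forall w, w = \sum_i c i w *: e i) -> end_trace X = \sum_i c i (X (e i)).
Proof.
move=> frame; pose b := vbasis {:W}; rewrite /end_trace /mxtrace.
transitivity (\sum_(k < \dim {:W}) coord b k (X b`_k)).
  apply: eq_bigr => k _; rewrite mxE /= mxE; congr (coord _ _ (X _)).
  exact: passmx.vecof_delta.
transitivity (\sum_(k < \dim {:W}) \sum_i c i b`_k * coord b k (X (e i))).
  apply: eq_bigr => k _; rewrite {1}[b`_k]frame !linear_sum /=.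
  by apply: eq_bigr => i _; rewrite !linearZ.
rewrite exchange_big /=; apply: eq_bigr => i _.
rewrite [X (e i) in RHS](coord_basis (vbasisP {:W}) (memvf _)) linear_sum /=.
by apply: eq_bigr => k _; rewrite linearZ /= mulrC.
Qed.
(** * The operator that a family of matrices induces on powers of a space *)

Section Operators.
Variables (K : fieldType) (V : vectType K) (t : nat).

Definition mxact n m (T : 'M[K]_(n, m)) (x : {ffun 'I_m -> V}) :
    {ffun 'I_n -> V} := [ffun i => \sum_j T i j *: x j].

Fact mxact_is_linear n m (T : 'M[K]_(n, m)) : linear (mxact T).
Proof.
move=> a x y; apply/ffunP => i; rewrite !ffunE scaler_sumr -big_split /=.
apply: eq_bigr => j _; rewrite !ffunE scalerDr !scalerA.
by rewrite [T i j * a]mulrC.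
Qed.

HB.instance Definition _ n m (T : 'M[K]_(n, m)) :=
  GRing.isLinear.Build K {ffun 'I_m -> V} {ffun 'I_n -> V} _ (mxact T)
    (mxact_is_linear T).

Definition mxact_lin n m (T : 'M[K]_(n, m)) := linfun (mxact T).

Lemma mxact_linM n m l (S : 'M[K]_(n, m)) (T : 'M_(m, l)) :
  (mxact_lin S \o mxact_lin T)%VF = mxact_lin (S *m T).
Proof.
apply/lfunP => x; rewrite comp_lfunE !lfunE /=.
apply/ffunP => i; rewrite !ffunE.
under eq_bigr do rewrite ffunE scaler_sumr.
rewrite exchange_big /=; apply: eq_bigr => j _; rewrite mxE scaler_suml.
by apply: eq_bigr => k _; rewrite scalerA.
Qed.

Lemma mxact_linD n m (S T : 'M[K]_(n, m)) :
  mxact_lin S + mxact_lin T = mxact_lin (S + T).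
Proof.
apply/lfunP => x; rewrite add_lfunE !lfunE; apply/ffunP => i; rewrite !ffunE.
by rewrite -big_split; apply: eq_bigr => j _; rewrite mxE scalerDl.
Qed.

Lemma mxact_lin1 n : mxact_lin (1%:M : 'M[K]_n) = \1%VF.
Proof.
apply/lfunP => x; rewrite !lfunE; apply/ffunP => i; rewrite !ffunE.
rewrite (bigD1 i) //= big1 ?addr0; first by rewrite mxE eqxx scale1r.
by move=> j /negPf; rewrite mxE eq_sym => ->; rewrite scale0r.
Qed.

Lemma mxact_lin0 n m : mxact_lin (0 : 'M[K]_(n, m)) = 0.
Proof.
apply/lfunP => x; rewrite !lfunE; apply/ffunP => i; rewrite !ffunE.
by rewrite big1 // => j _; rewrite mxE scale0r.
Qed.

(** The operator [\sum_s X_s (x) C_s] on the tensor product of [K^n] and [V].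
    Both sides of the multiplicity formula have this shape. *)
Definition rep_block n (X : 'I_t -> 'M[K]_n) (C : 'I_t -> 'End(V)) :=
  eval_block (fun i j => \row_s X s i j) C.

Lemma rep_blockE n (X : 'I_t -> 'M[K]_n) (C : 'I_t -> 'End(V)) x :
  rep_block X C x = \sum_s mxact_lin (X s) [ffun j => C s (x j)].
Proof.
rewrite lfunE /=; apply/ffunP => i; rewrite ffunE sum_ffunE.
under [RHS]eq_bigr do rewrite lfunE ffunE.
rewrite exchange_big /=; apply: eq_bigr => j _.
rewrite sum_lfunE; apply: eq_bigr => s _.
by rewrite mxE scale_lfunE ffunE.
Qed.

Lemma eq_rep_block n (X Y : 'I_t -> 'M[K]_n) (C : 'I_t -> 'End(V)) :
  X =1 Y -> rep_block X C = rep_block Y C.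
Proof.
move=> eXY; apply/lfunP => x; rewrite !rep_blockE.
by apply: eq_bigr => s _; rewrite eXY.
Qed.

(** A scalar matrix commutes past every [C_s], so compressing the matrices
    [X_s] compresses the operator. *)
Lemma compress_rep_blockE n m l (G : 'M[K]_(m, n)) (X : 'I_t -> 'M[K]_n)
    (H : 'M_(n, l)) (C : 'I_t -> 'End(V)) x :
  mxact_lin G (rep_block X C (mxact_lin H x)) =
  \sum_s mxact_lin (G *m X s *m H) [ffun j => C s (x j)].
Proof.
rewrite rep_blockE linear_sum /=; apply: eq_bigr => s _.
rewrite -!mxact_linM !comp_lfunE; congr (mxact_lin _ (mxact_lin _ _)).
apply/ffunP => j; rewrite ffunE !lfunE !ffunE linear_sum.
by apply: eq_bigr => k _; rewrite linearZ ffunE.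
Qed.

Lemma compress_rep_block n l (G : 'M[K]_(l, n)) (X : 'I_t -> 'M[K]_n)
    (H : 'M_(n, l)) (C : 'I_t -> 'End(V)) :
  (mxact_lin G \o (rep_block X C \o mxact_lin H))%VF =
  rep_block (fun s => G *m X s *m H) C.
Proof.
by apply/lfunP => x; rewrite !comp_lfunE compress_rep_blockE rep_blockE.
Qed.

Definition ffun_coord n (u : 'I_n * 'I_(\dim {:V})) (x : {ffun 'I_n -> V}) :
    K :=
  coord (vbasis {:V}) u.2 (x u.1).

Fact ffun_coord_is_scalar n (u : 'I_n * 'I_(\dim {:V})) : scalar (ffun_coord u).
Proof. by move=> a x y; rewrite /ffun_coord !ffunE linearP. Qed.

HB.instance Definition _ n (u : 'I_n * 'I_(\dim {:V})) :=
  GRing.isLinear.Build K {ffun 'I_n -> V} K *%R (ffun_coord u)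
    (ffun_coord_is_scalar u).

Lemma end_trace_rep_block n (X : 'I_t -> 'M[K]_n) (C : 'I_t -> 'End(V)) :
  end_trace (rep_block X C) = \sum_s \tr (X s) * end_trace (C s).
Proof.
pose b := vbasis {:V}.
pose e (u : 'I_n * 'I_(\dim {:V})) : {ffun 'I_n -> V} :=
  [ffun j => (j == u.1)%:R *: b`_u.2].
have frame x : x = \sum_u ffun_coord u x *: e u.
  apply/ffunP => j; rewrite sum_ffunE.
  rewrite {1}(coord_vbasis (memvf (x j))).
  rewrite -(pair_bigA _ (fun i k => (ffun_coord (i, k) x *: e (i, k)) j)) /=.
  rewrite (bigD1 j) //= [X in _ + X]big1 ?addr0 => [|i /negPf ij].
    by apply: eq_bigr => k _; rewrite !ffunE /= eqxx scale1r.
  by rewrite big1 // => k _; rewrite !ffunE /= eq_sym ij scale0r scaler0.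
have frameV v : v = \sum_k coord b k v *: b`_k := coord_vbasis (memvf v).
rewrite (end_trace_frame (c := @ffun_coord n) _ frame).
transitivity (\sum_(i < n) \sum_(k < \dim {:V})
    \sum_s X s i i * coord b k (C s b`_k)).
  rewrite -(pair_bigA _
    (fun i k => ffun_coord (i, k) (rep_block X C (e (i, k))))) /=.
  apply: eq_bigr => i _; apply: eq_bigr => k _.
  rewrite rep_blockE linear_sum; apply: eq_bigr => s _.
  rewrite /= /ffun_coord /= lfunE /= ffunE linear_sum /= (bigD1 i) //=.
  rewrite big1 ?addr0 => [|j /negPf ji].
    by rewrite !ffunE /= eqxx scale1r linearZ.
  by rewrite !ffunE /= ji scale0r !(linear0, scaler0).
under eq_bigr do rewrite exchange_big /=.
rewrite exchange_big /=; apply: eq_bigr => s _; rewrite mulr_suml.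
apply: eq_bigr => i _; rewrite -mulr_sumr.
by rewrite (end_trace_frame (c := fun k => coord b k) _ frameV).
Qed.

Lemma rep_block_biproduct w u u' (G : 'M[K]_(u, w)) (G' : 'M_(w, u))
    (H : 'M_(w, u')) (H' : 'M_(u', w)) (X : 'I_t -> 'M_w) C :
  biproduct G G' H H' -> (forall s, G *m X s *m H = 0) ->
  char_poly (mx_of_end (rep_block X C)) =
    char_poly (mx_of_end (rep_block (fun s => G *m X s *m G') C)) *
    char_poly (mx_of_end (rep_block (fun s => H' *m X s *m H) C)).
Proof.
case=> GG HH GH E GXH.
rewrite -(compress_rep_block G X G') -(compress_rep_block H' X H).
apply: (proj1 (@char_poly_trace_End _ _ _ _ _ _ _ _ _ _ _ _ _ _));
  rewrite ?mxact_linM ?mxact_linD ?GG ?HH ?GH ?E ?mxact_lin1 ?mxact_lin0 //.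
apply/lfunP => x; rewrite !comp_lfunE compress_rep_blockE lfunE /=.
by rewrite big1 // => s _; rewrite GXH mxact_lin0 lfunE.
Qed.

End Operators.
(** * Irreducible representations and their matrix coefficients *)

Section Representations.
Variables (K : numClosedFieldType) (t : nat).
Variables (one : 'I_t) (mul : 'I_t -> 'I_t -> 'I_t).

(** Several arrow types may define the same input map and a product of types is
    only chosen up to this ambiguity, so [mul] need not be associative nor
    [one] neutral; the two laws hold for the matrices that represent them. *)
Record rep := Rep {
  rdim : nat;
  rmx :> 'I_t -> 'M[K]_rdim;
  rep_one : rmx one = 1%:M;
  rep_mul : forall c d, rmx (mul c d) = rmx c *m rmx d
}.

Implicit Types X Y Z : rep.

Definition intertwiner X Y (T : 'M[K]_(rdim X, rdim Y)) :=
  forall s, X s *m T = T *m Y s.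

Definition iso X Y := exists (T : 'M[K]_(rdim X, rdim Y)) T',
  [/\ intertwiner T, T *m T' = 1%:M & T' *m T = 1%:M].

Definition irr X := (0 < rdim X)%N /\
  forall m (U : 'M[K]_(m, rdim X)),
    (forall s, stablemx U (X s)) -> U != 0 -> row_full U.

Lemma iso_sym X Y : iso X Y -> iso Y X.
Proof.
case=> T [T' [iT TT T'T]]; exists T', T; split=> // s.
by rewrite -[Y s]mul1mx -T'T -(mulmxA T') -iT -!mulmxA TT mulmx1.
Qed.

Lemma stable_kermx X Y (T : 'M[K]_(rdim X, rdim Y)) (s : 'I_t) :
  intertwiner T -> stablemx (kermx T) (X s).
Proof.
by move=> iT; apply/sub_kermxP; rewrite -mulmxA iT mulmxA mulmx_ker mul0mx.
Qed.

Lemma irr_ker X Y (T : 'M[K]_(rdim X, rdim Y)) :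
  irr X -> intertwiner T -> T != 0 -> row_free T.
Proof.
move=> [_ irrX] iT; rewrite -kermx_eq0; apply: contraNT => /irrX full.
have /full : forall s, stablemx (kermx T) (X s).
  by move=> s; exact: stable_kermx.
by rewrite -sub1mx => /sub_kermxP; rewrite mul1mx => ->.
Qed.

(** Kernel and image of [T] are stable, hence zero and everything. *)
Lemma schur X Y (T : 'M[K]_(rdim X, rdim Y)) :
  irr X -> irr Y -> intertwiner T -> T != 0 -> iso X Y.
Proof.
move=> irrX irrY iT T0; have fT := irr_ker irrX iT T0.
have uT : row_full T by apply: irrY.2 => // s; rewrite -iT submxMl.
exists T, (pinvmx T); split=> //; [exact: mulmxVp | exact: mulVpmx].
Qed.

(** For an eigenvalue [a], the kernel of [T - a] is nonzero and stable. *)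
Lemma schur_scalar X (T : 'M[K]_(rdim X)) :
  irr X -> intertwiner (X := X) (Y := X) T -> exists a, T = a%:M.
Proof.
move=> irrX iT.
have /closed_rootP[a ra] : size (char_poly T) != 1%N.
  by rewrite size_char_poly eqSS -lt0n irrX.1.
exists a; apply/eqP; rewrite -subr_eq0; apply: contraTT ra => Ta.
rewrite -eigenvalue_root_char /eigenvalue /eigenspace negbK kermx_eq0.
apply: (irr_ker (Y := X)) => // s.
by rewrite mulmxBr mulmxBl iT scalar_mxC.
Qed.

(** The rows [v X_u] span a stable subspace because [v X_u X_s = v X_(mul u s)],
    and it contains [v = v X_one]. *)
Lemma irr_orbit X (v : 'rV[K]_(rdim X)) : irr X -> v != 0 ->
  exists C : 'M_(rdim X, t), C *m (\matrix_u (v *m X u)) = 1%:M.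
Proof.
move=> [_ irrX] v0; set U := \matrix_u _.
have /irrX full : forall s, stablemx U (X s).
  move=> s; apply/row_subP => u; rewrite row_mul rowK -mulmxA -rep_mul.
  by rewrite -(rowK (fun u => v *m X u)) row_sub.
have /full : U != 0.
  apply: contraNneq v0 => U0; have := rowK (fun u => v *m X u) one.
  by rewrite -/U U0 row0 rep_one mulmx1 => <-.
by rewrite -sub1mx => /submxP[C ->]; exists C.
Qed.

Section Independence.
Variables (L : finType) (S : L -> rep).
Hypothesis irrS : forall l, irr (S l).
Hypothesis nisoS : forall l l', l != l' -> ~ iso (S l) (S l').
Let I := {l : L & 'I_(rdim (S l))}.

Lemma intertwiner_entry l0 l (i0 : 'I_(rdim (S l0))) (i : 'I_(rdim (S l)))
    (T : 'M[K]_(rdim (S l0), rdim (S l))) :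
  intertwiner T -> Tagged _ i != Tagged _ i0 :> I -> T i0 i = 0.
Proof.
have [e|ll0] := eqVneq l0 l.
  subst l => iT ii0; have [c ->] := schur_scalar (irrS l0) iT.
  rewrite mxE; case: eqP => // e; by rewrite e eqxx in ii0.
move=> iT _; apply/eqP/negP => /negP T0; apply: (nisoS ll0).
apply: (schur (T := T)) => //; apply: contraNneq T0 => ->.
by rewrite mxE.
Qed.

(** Independence of all matrix coefficients [s |-> S_l(s)_{ij}].  Suppose that a
    relation has a nonzero component [v q0].  Translating the relation by
    the arrow types and combining the translates replaces each [v q] by a
    matrix [V q] with [V q0 = 1]; by induction on the number of terms,
    each [V q] intertwines [S (tag q0)] and [S (tag q)].  By Schur's lemma [V q]
    vanishes or is scalar, and at [s = one] only the term [q0] survives. *)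
Lemma matrix_coef_indep (Q : {set I})
    (v : forall q : I, 'rV[K]_(rdim (S (tag q)))) :
  (forall s, \sum_(q in Q) (v q *m S (tag q) s) 0 (tagged q) = 0) ->
  forall q, q \in Q -> v q = 0.
Proof.
have [m] := ubnP #|Q|; elim: m Q v => // m IH Q v ltQ rel q0 q0Q.
apply/eqP/negP => /negP v0; have [C C1] := irr_orbit (irrS _) v0.
pose V q := C *m (\matrix_u (v q *m S (tag q) u)).
have relV a s : \sum_(q in Q) (V q *m S (tag q) s) a (tagged q) = 0.
  transitivity (\sum_u C a u *
      \sum_(q in Q) (v q *m S (tag q) (mul u s)) 0 (tagged q)).
    under [RHS]eq_bigr do rewrite mulr_sumr.
    rewrite exchange_big /=; apply: eq_bigr => q _.
    rewrite -mulmxA mxE; apply: eq_bigr => u _; congr (_ * _).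
    rewrite rep_mul mulmxA -[in RHS](rowK (fun u => v q *m S (tag q) u)).
    by rewrite -row_mul [RHS]mxE.
  by rewrite big1 // => u _; rewrite rel mulr0.
have iV q : q \in Q -> intertwiner (X := S (tag q0)) (Y := S (tag q)) (V q).
  move=> qQ w; have [->|qq0] := eqVneq q q0.
    by rewrite /V C1 mulmx1 mul1mx.
  apply/eqP; rewrite -subr_eq0; apply/eqP/row_matrixP => a; rewrite row0.
  pose D q := row a (S (tag q0) w *m V q - V q *m S (tag q) w).
  apply: (IH (Q :\ q0) D); last by rewrite !inE qq0.
    by rewrite -ltnS (leq_trans _ ltQ) // [in X in (_ < X)%N](cardsD1 q0) q0Q.
  move=> s.
  have D0 : (D q0 *m S (tag q0) s) 0 (tagged q0) = 0.
    by rewrite /D /V C1 mulmx1 mul1mx subrr row0 mul0mx mxE.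
  transitivity (\sum_(q in Q) (D q *m S (tag q) s) 0 (tagged q)).
    by rewrite [RHS](big_setD1 q0) //= D0 add0r.
  transitivity (\sum_b S (tag q0) w a b *
       (\sum_(q in Q) (V q *m S (tag q) s) b (tagged q))
     - \sum_(q in Q) (V q *m S (tag q) (mul w s)) a (tagged q)).
    under [X in X - _]eq_bigr do rewrite mulr_sumr.
    rewrite exchange_big /= -sumrB; apply: eq_bigr => p _.
    rewrite /D -row_mul mxE mulmxBl mxE [in X in _ + X]mxE -!mulmxA mxE.
    by rewrite rep_mul mulmxA.
  by rewrite relV subr0 big1 // => b _; rewrite relV mulr0.
have V0 q : q \in Q -> q != q0 -> V q (tagged q0) (tagged q) = 0.
  move=> /iV iT qq0; apply: intertwiner_entry iT _.
  by apply: contraNneq qq0; case: (q) => ? ?; case: (q0) => ? ? e; apply/eqP.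
have := relV (tagged q0) one; rewrite (bigD1 q0) //= big1 => [|q /andP[qQ qq0]].
  by rewrite rep_one mulmx1 /V C1 addr0 mxE eqxx => /eqP; rewrite oner_eq0.
by rewrite rep_one mulmx1 V0.
Qed.

Definition coef l (i j : 'I_(rdim (S l))) : 'rV[K]_t := \row_s S l s i j.

Lemma coef_free :
  free [seq coef (tagged u).1 (tagged u).2
       | u : {l : L & ('I_(rdim (S l)) * 'I_(rdim (S l)))%type}].
Proof.
pose J : finType := {l : L & ('I_(rdim (S l)) * 'I_(rdim (S l)))%type}%type.
pose f (u : J) := coef (tagged u).1 (tagged u).2.
apply/(@freeP _ _ _ (image_tuple f xpredT)) => k rel.
pose a (u : J) := k (enum_rank u).
have {}rel s : \sum_u a u * S (tag u) s (tagged u).1 (tagged u).2 = 0.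
  have := congr1 (fun w : 'rV[K]_t => w 0 s) rel.
  rewrite summxE mxE; apply: etrans.
  rewrite (reindex_onto (@enum_val _ J) enum_rank) /=; last first.
    by move=> *; exact: enum_rankK.
  apply: eq_big => [i|i _]; first by rewrite enum_valK eqxx.
  by rewrite /a enum_valK mxE (nth_image _ _ i) mxE.
pose v (q : I) : 'rV_(rdim (S (tag q))) := \row_i a (Tagged _ (i, tagged q)).
have v0 q : v q = 0.
  apply: (@matrix_coef_indep setT) => // s; rewrite -[RHS](rel s).
  transitivity (\sum_l \sum_j \sum_i a (Tagged _ (i, j)) * S l s i j).
    rewrite (sig_big_dep (I := L) (J := fun l => 'I_(rdim (S l)))) /=.
    apply: eq_big => [q'|q' _]; first by rewrite inE.
    by rewrite mxE; apply: eq_bigr => i _; rewrite mxE.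
  under eq_bigr do rewrite exchange_big /= pair_bigA /=.
  rewrite (sig_big_dep (I := L)) /=.
  by apply: eq_big => // -[l [i j]].
move=> i; transitivity (a (enum_val i)); first by rewrite /a enum_valK.
case: (enum_val i) => l [p r].
have := v0 (Tagged (fun l => 'I_(rdim (S l))) r).
move/(congr1 (fun w : 'rV[K]_(rdim (S l)) => w 0 p)).
by rewrite !mxE.
Qed.

(** The left-hand side counts the matrix coefficients, which are independent
    vectors of a space of dimension [t]. *)
Lemma sum_rdim_sqr_le : (\sum_l rdim (S l) ^ 2 <= t)%N.
Proof.
have := eqP coef_free; rewrite size_map -cardE card_tagged.
rewrite sumnE big_map -big_enum.
under eq_bigr do rewrite card_prod card_ord mulnn.
move=> <-; apply: leq_trans (dimvS (subvf _)) _.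
by rewrite dimvf dim_matrix mul1r.
Qed.

(** The diagonal coefficients of all the [S l] are independent, so the
    differences of the multiplicities vanish in [K], which has characteristic
    zero. *)
Lemma character_inj (m m' : L -> nat) :
  (forall s, \sum_l (m l)%:R * \tr (S l s) = \sum_l (m' l)%:R * \tr (S l s)) ->
  m =1 m'.
Proof.
move=> e l; apply/eqP; rewrite -(@eqr_nat K) -subr_eq0; apply/eqP.
pose v (q : I) : 'rV[K]_(rdim (S (tag q))) :=
  ((m (tag q))%:R - (m' (tag q))%:R) *: delta_mx 0 (tagged q).
have := @matrix_coef_indep setT v.
have /[swap]/[apply] : forall s,
    \sum_(q in setT) (v q *m S (tag q) s) 0 (tagged q) = 0.
  move=> s.
  transitivity (\sum_l \sum_i ((m l)%:R - (m' l)%:R) * S l s i i).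
    rewrite (sig_big_dep (I := L) (J := fun l => 'I_(rdim (S l)))) /=.
    apply: eq_big => [q|q _]; first by rewrite inE.
    by rewrite -scalemxAl -rowE !mxE.
  under eq_bigr do rewrite -mulr_sumr -/(\tr _) mulrBl.
  by rewrite sumrB e subrr.
case: (irrS l) => n0 _.
move=> /(_ (Tagged (fun l => 'I_(rdim (S l))) (Ordinal n0)) (in_setT _)).
move/(congr1 (fun w : 'rV[K]_(rdim (S l)) => w 0 (Ordinal n0))).
by rewrite !mxE !eqxx mulr1.
Qed.
End Independence.
End Representations.
(** * Composition multiplicities *)

Section Constituents.
Variables (K : numClosedFieldType) (t : nat).
Variables (one : 'I_t) (mul : 'I_t -> 'I_t -> 'I_t).
Notation rep := (rep K one mul).
Implicit Types X Y Z : rep.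

Program Definition triv_rep : rep := @Rep K t one mul 1 (fun _ => 1%:M) _ _.
Next Obligation. by rewrite mulmx1. Qed.

Program Definition zero_rep : rep := @Rep K t one mul 0 (fun _ => 0) _ _.
Next Obligation. by rewrite [RHS]flatmx0. Qed.
Next Obligation. by rewrite mulmx0. Qed.

Lemma irr_triv_rep : irr triv_rep.
Proof.
split=> // m U _; rewrite -mxrank_eq0 -lt0n => U0.
by rewrite /row_full eqn_leq rank_leq_col.
Qed.

(** [X] is block triangular with diagonal blocks [Y] and [Z] in the basis that
    the biproduct provides. *)
Definition extension X Y Z :=
  exists (G : 'M[K]_(rdim Y, rdim X)) G' (H : 'M_(rdim X, rdim Z)) H',
  [/\ biproduct G G' H H', forall s, G *m X s *m H = 0,
      Y =1 (fun s => G *m X s *m G') & Z =1 (fun s => H' *m X s *m H)].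

Lemma extension_dim X Y Z : extension X Y Z -> rdim X = (rdim Y + rdim Z)%N.
Proof. by case=> G [G' [H [H' [/biproduct_dim]]]]. Qed.

(** The diagonal blocks of a block triangular representation are
    representations: [G' G] and [1] differ by [H H'], which [G X_c] kills. *)
Lemma rep_sub X u u' (G : 'M[K]_(u, rdim X)) (G' : 'M_(rdim X, u))
    (H : 'M_(rdim X, u')) (H' : 'M_(u', rdim X)) :
  biproduct G G' H H' -> (forall s, G *m X s *m H = 0) ->
  G *m X one *m G' = 1%:M /\
  forall c d, G *m X (mul c d) *m G' = (G *m X c *m G') *m (G *m X d *m G').
Proof.
move=> bip GXH; case: (bip) => GG HH GH E; split=> [|c d].
  by rewrite rep_one mulmx1.
have -> : (G *m X c *m G') *m (G *m X d *m G') =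
          G *m X c *m (G' *m G) *m (X d *m G') by rewrite !mulmxA.
have -> : G' *m G = 1%:M - H *m H' by rewrite -E addrK.
rewrite mulmxBr mulmx1 mulmxBl !(mulmxA (G *m X c) H) GXH.
by rewrite !mul0mx subr0 rep_mul !mulmxA.
Qed.

Lemma rep_quot X u u' (G : 'M[K]_(u, rdim X)) (G' : 'M_(rdim X, u))
    (H : 'M_(rdim X, u')) (H' : 'M_(u', rdim X)) :
  biproduct G G' H H' -> (forall s, G *m X s *m H = 0) ->
  H' *m X one *m H = 1%:M /\
  forall c d, H' *m X (mul c d) *m H = (H' *m X c *m H) *m (H' *m X d *m H).
Proof.
move=> bip GXH; case: (bip) => GG HH GH E; split=> [|c d].
  by rewrite rep_one mulmx1.
have -> : (H' *m X c *m H) *m (H' *m X d *m H) =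
          H' *m X c *m ((H *m H') *m (X d *m H)) by rewrite !mulmxA.
have -> : H *m H' = 1%:M - G' *m G by rewrite -E addrC addKr.
rewrite mulmxBl mul1mx -(mulmxA G') (mulmxA G) GXH mulmx0 subr0.
by rewrite rep_mul !mulmxA.
Qed.

Lemma extension_stable X m (U : 'M[K]_(m, rdim X)) :
  (forall s, stablemx U (X s)) ->
  exists Y Z, extension X Y Z /\ rdim Y = \rank U.
Proof.
move=> stU.
have [G' [u' [H [H' bip]]]] := biproduct_left (row_base_free U).
have GXH s : row_base U *m X s *m H = 0.
  case: bip => _ _ GH _.
  have /submxP[W ->] : (row_base U *m X s <= row_base U)%MS.
    by rewrite eq_row_base (submx_trans _ (stU s)) // submxMr ?eq_row_base.
  by rewrite -mulmxA GH mulmx0.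
have [Y1 YM] := rep_sub bip GXH; have [Z1 ZM] := rep_quot bip GXH.
exists (Rep Y1 YM), (Rep Z1 ZM); split=> //.
by exists (row_base U), G', H, H'; split.
Qed.

Lemma extension_intertwiner X Z (H : 'M[K]_(rdim X, rdim Z)) H' :
  intertwiner H -> H' *m H = 1%:M -> exists Y, extension X Y Z.
Proof.
move=> iH HH; have [u [G [G' bip]]] := biproduct_right HH.
have GXH s : G *m X s *m H = 0.
  by case: bip => _ _ GH _; rewrite -mulmxA iH mulmxA GH mul0mx.
have [Y1 YM] := rep_sub bip GXH.
exists (Rep Y1 YM), G, G', H, H'; split=> // s.
by rewrite -mulmxA iH mulmxA HH mul1mx.
Qed.

Lemma extension_iso X Z : iso X Z -> extension X zero_rep Z.
Proof.
case=> T [T' [iT TT T'T]]; exists 0, 0, T, T'; split=> // [|s|s|s].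
- by split; rewrite ?mul0mx ?add0r // [LHS]flatmx0 [RHS]flatmx0.
- by rewrite !mul0mx.
- by rewrite !mul0mx.
by rewrite -mulmxA iT mulmxA T'T mul1mx.
Qed.

Section Family.
Variables (L : finType) (S : L -> rep).

(** [m] lists the multiplicities of the representations [S l] as composition
    factors of [X], recorded through the two invariants that are additive
    along extensions. *)
Definition constituents X (m : L -> nat) :=
  (forall s, \tr (X s) = \sum_l (m l)%:R * \tr (S l s)) /\
  (forall (V : vectType K) (C : 'I_t -> 'End(V)),
     char_poly (mx_of_end (rep_block X C)) =
     \prod_l char_poly (mx_of_end (rep_block (S l) C)) ^+ m l).

Lemma constituents_extension X Y Z m m' : extension X Y Z ->
  constituents Y m -> constituents Z m' ->
  constituents X (fun l => (m l + m' l)%N).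
Proof.
case=> G [G' [H [H' [bip GXH eY eZ]]]] [trY cY] [trZ cZ]; split=> [s|V C].
  have [_ ->] := char_poly_trace_biproduct bip (GXH s).
  rewrite -eY -eZ trY trZ -big_split; apply: eq_bigr => l _.
  by rewrite natrD mulrDl.
rewrite (rep_block_biproduct _ bip GXH).
rewrite -(eq_rep_block C eY) -(eq_rep_block C eZ) cY cZ -big_split.
apply: eq_bigr => l _.
by rewrite exprD.
Qed.

Lemma constituents_dim0 X : rdim X = 0%N -> constituents X (fun _ => 0%N).
Proof.
move=> X0; split=> [s|V C].
  rewrite big1 => [|l _]; last by rewrite mul0r.
  by rewrite /mxtrace big1 // => -[i ltiX] _; have := ltiX; rewrite {1}X0.
have [|-> _] := char_poly_trace_dim0 (rep_block X C); last first.
  by rewrite big1 // => l _; rewrite expr0.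
by rewrite dimvf /dim /= card_ord X0 mul0n.
Qed.

Lemma constituents_self l : constituents (S l) (fun l' => (l' == l)%N).
Proof.
split=> [s|V C].
  rewrite (bigD1 l) //= big1 ?addr0 => [|l' /negPf ->]; last by rewrite mul0r.
  by rewrite eqxx mul1r.
rewrite (bigD1 l) //= big1 ?mulr1 => [|l' /negPf ->]; last by rewrite expr0.
by rewrite eqxx expr1.
Qed.

Lemma constituents_iso X l : iso X (S l) ->
  constituents X (fun l' => (l' == l)%N).
Proof.
move=> /extension_iso ext.
exact: constituents_extension ext (constituents_dim0 _) (constituents_self l).
Qed.

(** Induction on the dimension: a representation that is not irreducible is an
    extension of two smaller ones. *)
Lemma constituents_exist : (forall X, irr X -> exists l, iso X (S l)) ->
  forall X, exists m, constituents X m.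
Proof.
move=> complete X; have [n] := ubnP (rdim X); elim: n X => // n IH X ltXn.
apply: contrapT => nC.
have X0 : (0 < rdim X)%N.
  by case: posnP => // /constituents_dim0 ?; case: nC; exists (fun=> 0%N).
have /complete[l /constituents_iso cX] : irr X; last first.
  by apply: nC; eexists; exact: cX.
split=> // m U stU U0; apply/negPn/negP => nfull; apply: nC.
have [Y [Z [ext dY]]] := extension_stable stU.
have dX := extension_dim ext.
have ltU : (\rank U < rdim X)%N by rewrite ltn_neqAle nfull rank_leq_col.
have posU : (0 < \rank U)%N by rewrite lt0n mxrank_eq0.
have [mY cY] : exists m, constituents Y m.
  by apply: IH; rewrite dY (leq_trans ltU).
have [mZ cZ] : exists m, constituents Z m.
  by apply: IH; rewrite -ltnS (leq_trans _ ltXn) // ltnS dX dY -add1n leq_add2r.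
by eexists; exact: constituents_extension ext cY cZ.
Qed.

Hypothesis irrS : forall l, irr (S l).
Hypothesis nisoS : forall l l', l != l' -> ~ iso (S l) (S l').
Hypothesis complete : forall X, irr X -> exists l, iso X (S l).

Lemma constituents_inj X m m' :
  constituents X m -> constituents X m' -> m =1 m'.
Proof.
move=> [trm _] [trm' _]; apply: (character_inj irrS nisoS) => s.
by rewrite -trm -trm'.
Qed.

Lemma constituents_dim X m :
  constituents X m -> (\sum_l m l * rdim (S l))%N = rdim X.
Proof.
move=> [tr _]; apply/eqP; rewrite -(@eqr_nat K) natr_sum; have := tr one.
rewrite rep_one mxtrace1 => ->; apply/eqP; apply: eq_bigr => l _.
by rewrite rep_one mxtrace1 natrM.
Qed.

Lemma constituents_le X Z m m' (H : 'M[K]_(rdim X, rdim Z)) H' :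
  intertwiner H -> H' *m H = 1%:M ->
  constituents X m -> constituents Z m' -> forall l, (m' l <= m l)%N.
Proof.
move=> iH HH cX cZ l; have [Y ext] := extension_intertwiner iH HH.
have [mY cY] := constituents_exist complete Y.
rewrite -(constituents_inj (constituents_extension ext cY cZ) cX).
exact: leq_addl.
Qed.

End Family.

(** A family of pairwise non-isomorphic irreducible representations has at most
    [t] members, so one that starts with the trivial representation
    extends to a complete one. *)
Lemma complete_family : exists k (S : 'I_k.+1 -> rep),
  [/\ S ord0 = triv_rep, forall l, irr (S l),
      forall l l', l != l' -> ~ iso (S l) (S l') &
      forall X, irr X -> exists l, iso X (S l)].
Proof.
pose family k (S : 'I_k.+1 -> rep) := [/\ S ord0 = triv_rep,
  forall l, irr (S l) & forall l l', l != l' -> ~ iso (S l) (S l')].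
have lt_t k (S : 'I_k.+1 -> rep) : family k S -> (k < t)%N.
  case=> _ irrS nisoS; apply: leq_trans (sum_rdim_sqr_le irrS nisoS).
  rewrite -[X in (X <= _)%N]card_ord -sum1_card; apply: leq_sum => l _.
  by rewrite expn_gt0 (irrS l).1.
(* The bound [k < t] makes [t - k] a measure for adding irreducibles. *)
suff grow d k (S : 'I_k.+1 -> rep) : (t - k <= d)%N -> family k S ->
    exists k (S : 'I_k.+1 -> rep), family k S /\
      forall X, irr X -> exists l, iso X (S l).
  have [||k [S [[S0 irrS nisoS] compl]]] := grow t 0%N (fun _ => triv_rep).
  - by rewrite leq_subr.
  - by split=> // [l|l l']; [exact: irr_triv_rep | rewrite !ord1].
  by exists k, S; split.
elim: d k S => [|d IH] k S tk fS; have k_lt_t := lt_t k S fS.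
  by move: tk; rewrite leqn0 subn_eq0 leqNgt k_lt_t.
case: fS => S0 irrS nisoS; apply: contrapT => nC.
have [X irrX nX] : exists2 X, irr X & forall l, ~ iso X (S l).
  apply: contrapT => nX; apply: nC; exists k, S; split=> // X irrX.
  apply: contrapT => nl; apply: nX; exists X => // l iXS; apply: nl.
  by exists l.
apply: nC.
(* [X] is put last, so that the trivial representation stays first. *)
pose S' (i : 'I_k.+2) := oapp S X (unlift ord_max i).
apply: (IH k.+1 S'); first by rewrite subnS -ltnS prednK ?subn_gt0.
split.
- have -> : ord0 = lift ord_max (ord0 : 'I_k.+1) by apply: val_inj.
  by rewrite /S' liftK.
- by move=> l; rewrite /S'; case: unliftP => [j|] _ /=.
move=> l l'; rewrite /S'; case: (unliftP ord_max l) => [j|] ->;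
  case: (unliftP ord_max l') => [j'|] -> /= ne //.
- by apply: nisoS; apply: contraNneq ne => ->.
- by move/iso_sym; exact: nX.
- by rewrite eqxx in ne.
Qed.

End Constituents.
(** * Networks as representations *)

Section FunctionMatrix.
Variable K : fieldType.

(** Pullback along [F]: the matrix, acting on column vectors, of the map
    [x |-> x \o F].  Composition is therefore reversed. *)
Definition function_mx (A B : finType) (F : A -> B) : 'M[K]_(#|A|, #|B|) :=
  \matrix_(i, j) (F (enum_val i) == enum_val j)%:R.

Lemma eq_function_mx (A B : finType) (F G : A -> B) :
  F =1 G -> function_mx F = function_mx G.
Proof. by move=> eFG; apply/matrixP => i j; rewrite !mxE eFG. Qed.

Lemma function_mx_mul (A B : finType) n (F : A -> B) (T : 'M[K]_(#|B|, n)) i j :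
  (function_mx F *m T) i j = T (enum_rank (F (enum_val i))) j.
Proof.
rewrite mxE (bigD1 (enum_rank (F (enum_val i)))) //= big1 ?addr0.
  by rewrite mxE enum_rankK eqxx mul1r.
move=> k kF; rewrite mxE; case: eqP => [e|_]; last by rewrite mul0r.
by case/eqP: kF; rewrite e enum_valK.
Qed.

Lemma function_mx_comp (A B D : finType) (F : A -> B) (G : B -> D) :
  function_mx F *m function_mx G = function_mx (G \o F).
Proof. by apply/matrixP => i j; rewrite function_mx_mul !mxE enum_rankK. Qed.

Lemma function_mx_id (A : finType) (F : A -> A) :
  F =1 id -> function_mx F = 1%:M.
Proof.
move=> F1; apply/matrixP => i j.
by rewrite !mxE F1 (inj_eq enum_val_inj).
Qed.

End FunctionMatrix.

Section Reindex.
Variables (K : fieldType) (V : vectType K) (t : nat).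

Definition reindex_ffun (A B : finType) (h : A -> B) (x : {ffun B -> V}) :
  {ffun A -> V} := [ffun a => x (h a)].

Fact reindex_ffun_is_linear (A B : finType) (h : A -> B) :
  linear (reindex_ffun h).
Proof. by move=> a x y; apply/ffunP => p; rewrite !ffunE. Qed.

HB.instance Definition _ (A B : finType) (h : A -> B) :=
  GRing.isLinear.Build K {ffun B -> V} {ffun A -> V} _ (reindex_ffun h)
    (reindex_ffun_is_linear h).

Definition ffun_eval (s : 'I_t) (x : {ffun 'I_t -> V}) : V := x s.

Fact ffun_eval_is_linear (s : 'I_t) : linear (ffun_eval s).
Proof. by move=> a x y; rewrite /ffun_eval !ffunE. Qed.

HB.instance Definition _ (s : 'I_t) :=
  GRing.isLinear.Build K {ffun 'I_t -> V} V _ (ffun_eval s)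
    (ffun_eval_is_linear s).

Lemma end_trace_id : end_trace (\1%VF : 'End(V)) = (\dim {:V})%:R.
Proof.
rewrite /end_trace /mx_of_end passmx.mxof1 ?mxtrace1 //.
exact: basis_free (vbasisP _).
Qed.

Lemma admissible_rep_block (M : network t) (f : 'Hom({ffun 'I_t -> V}, V))
    (C : 'I_t -> 'End(V)) : (forall X, f X = \sum_s C s (X s)) ->
  char_poly (mx_of_end (rep_block (fun s => function_mx K (@inp t M s)) C)) =
    char_poly (mx_of_end (admissible_lin M f)) /\
  end_trace (rep_block (fun s => function_mx K (@inp t M s)) C) =
    end_trace (admissible_lin M f).
Proof.
move=> fC.
pose p := linfun (@reindex_ffun 'I_#|M| M enum_val).
pose i := linfun (@reindex_ffun M 'I_#|M| enum_rank).
have pi : (p \o i = \1)%VF.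
  apply/lfunP => x; rewrite comp_lfunE !lfunE.
  by apply/ffunP => k; rewrite !ffunE enum_valK.
have ip : (i \o p = \1)%VF.
  apply/lfunP => x; rewrite comp_lfunE !lfunE.
  by apply/ffunP => k; rewrite !ffunE enum_rankK.
suff -> : rep_block (fun s => function_mx K (@inp t M s)) C =
    (p \o (admissible_lin M f \o i))%VF by exact: char_poly_trace_End_iso pi ip.
apply/lfunP => x; rewrite !comp_lfunE rep_blockE !lfunE.
apply/ffunP => k; rewrite sum_ffunE !ffunE fC; apply: eq_bigr => s _.
rewrite !ffunE !lfunE !ffunE (bigD1 (enum_rank (inp s (enum_val k)))) //=.
rewrite big1 ?addr0.
  by rewrite mxE enum_rankK eqxx scale1r ffunE.
move=> j jF; rewrite mxE; case: eqP => [e|_]; last by rewrite scale0r.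
by case/eqP: jF; rewrite e enum_valK.
Qed.

End Reindex.

(** * The class of a network and the multiplicities of its members *)

Section NetworkClass.
Variables (t : nat) (one : 'I_t) (mul : 'I_t -> 'I_t -> 'I_t).
Implicit Types M P : network t.

(** Recording one chosen product, instead of every coincidence between the input
    maps of a network and their composites, keeps the defining laws
    equational and is enough to make the pullbacks a representation. *)
Definition follows (M : network t) :=
  @inp t M one =1 id /\
  forall c d, @inp t M d \o @inp t M c =1 @inp t M (mul c d).

Lemma follows_complete (M : network t) : follows M -> complete M.
Proof. by case=> M1 MM; split; [exists one | move=> c d; exists (mul c d)]. Qed.

Lemma follows_subnetwork M (A : {set M}) (stA : stable A) :
  follows M -> follows (subnetwork stA).
Proof.
case=> M1 MM; split=> [u|c d u]; apply: val_inj => /=; first exact: M1.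
exact: MM.
Qed.

Lemma follows_quotient M P : follows M -> quotient_of P M -> follows P.
Proof.
case=> M1 MM [F fF sF]; split=> [q|c d q]; have [p <-] := sF q.
  by rewrite -fF M1.
by rewrite /= -!fF -MM.
Qed.

Lemma follows_disjoint_union M P :
  follows M -> follows P -> follows (disjoint_union M P).
Proof.
case=> M1 MM [P1 PM]; split=> [[p|q]|c d [p|q]] /=.
- by rewrite M1.
- by rewrite P1.
- by rewrite -MM.
- by rewrite -PM.
Qed.

Variable K : numClosedFieldType.

Lemma network_rep1 (M : network t) :
  follows M -> function_mx K (@inp t M one) = 1%:M.
Proof. by case=> M1 _; exact: function_mx_id. Qed.

Lemma network_repM (M : network t) : follows M -> forall c d,
  function_mx K (@inp t M (mul c d)) =
  function_mx K (@inp t M c) *m function_mx K (@inp t M d).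
Proof.
case=> _ MM c d; rewrite function_mx_comp.
by apply: eq_function_mx => p; rewrite -MM.
Qed.

Definition network_rep M (fM : follows M) : rep K one mul :=
  @Rep K t one mul _ (fun s => function_mx K (@inp t M s))
    (network_rep1 fM) (network_repM fM).

Variables (L : finType) (S : L -> rep K one mul).
Hypothesis irrS : forall l, irr (S l).
Hypothesis nisoS : forall l l', l != l' -> ~ iso (S l) (S l').
Hypothesis completeS : forall X, irr X -> exists l, iso X (S l).

(** Pullback along the fibration is an injective intertwiner; a section of the
    fibration provides its left inverse. *)
Lemma network_quotient_le M P (fM : follows M) (fP : follows P) m m' :
  quotient_of P M -> constituents S (network_rep fM) m ->
  constituents S (network_rep fP) m' -> forall l, (m' l <= m l)%N.
Proof.
case=> F fibF surF cM cP.
have [G GK] := choice surF.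
apply: (@constituents_le _ _ _ _ _ S irrS nisoS completeS (network_rep fM)
  (network_rep fP) _ _ (function_mx K F) (function_mx K G) _ _ cM cP).
  move=> s; rewrite !function_mx_comp.
  by apply: eq_function_mx => p /=; rewrite fibF.
by rewrite function_mx_comp; apply: function_mx_id.
Qed.

(** Constant functions form a trivial subrepresentation. *)
Lemma network_triv M (fM : follows M) m l0 : S l0 = triv_rep K one mul ->
  (0 < #|M|)%N -> constituents S (network_rep fM) m -> (1 <= m l0)%N.
Proof.
move=> S0 /card_gt0P[p _] cM; have := constituents_self S l0; rewrite S0 => c0.
rewrite -[1%N]/(true : nat) -(eqxx l0).
apply: (@constituents_le _ _ _ _ _ S irrS nisoS completeS (network_rep fM)
  (triv_rep K one mul) _ _ (const_mx 1) (delta_mx 0 (enum_rank p)) _ _ cM c0).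
  move=> s; apply/matrixP => i j; rewrite /= mulmx1 function_mx_mul !mxE //.
by rewrite -rowE; apply/matrixP => i j; rewrite !mxE !ord1.
Qed.

Lemma mup_prod (lambda : K) (p : L -> {poly K}) (m : L -> nat) :
  (forall l, p l != 0) ->
  mup lambda (\prod_l p l ^+ m l) = (\sum_l m l * mup lambda (p l))%N.
Proof.
move=> p0; have mup1 : mup lambda 1 = 0%N by rewrite mupNroot ?root1.
have mupX q n : q != 0 -> mup lambda (q ^+ n) = (n * mup lambda q)%N.
  move=> q0; elim: n => [|n IH]; first by rewrite expr0 mul0n.
  by rewrite exprS mupM ?expf_neq0 // IH mulSn.
suff [_ ->] : \prod_l p l ^+ m l != 0 /\
  mup lambda (\prod_l p l ^+ m l) = (\sum_l m l * mup lambda (p l))%N by [].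
elim/big_rec2: _ => [|l n q _ [q0 <-]]; first by rewrite oner_eq0.
by split; [rewrite mulf_neq0 ?expf_neq0 | rewrite mupM ?expf_neq0 // mupX].
Qed.

Lemma alg_mult_admissible M (fM : follows M) m (V : vectType K)
    (f : 'Hom({ffun 'I_t -> V}, V)) (C : 'I_t -> 'End(V)) lambda :
  constituents S (network_rep fM) m -> (forall X, f X = \sum_s C s (X s)) ->
  alg_mult lambda (admissible_lin M f) =
  (\sum_l m l * alg_mult lambda (rep_block (S l) C))%N.
Proof.
case=> _ cM fC; have [cf _] := admissible_rep_block M fC.
rewrite /alg_mult -cf (cM V C) mup_prod // => l.
by rewrite monic_neq0 ?char_poly_monic.
Qed.

Lemma end_trace_admissible M (fM : follows M) m (V : vectType K)
    (f : 'Hom({ffun 'I_t -> V}, V)) (C : 'I_t -> 'End(V)) :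
  constituents S (network_rep fM) m -> (forall X, f X = \sum_s C s (X s)) ->
  end_trace (admissible_lin M f) =
  \sum_l (m l)%:R * end_trace (rep_block (S l) C).
Proof.
case=> trM _ fC; have [_ <-] := admissible_rep_block M fC.
rewrite end_trace_rep_block; under eq_bigr do rewrite trM mulr_suml.
rewrite exchange_big; apply: eq_bigr => l _.
rewrite end_trace_rep_block mulr_sumr.
by apply: eq_bigr => s _; rewrite mulrA.
Qed.

(** The response [x |-> x s] already recovers the character value at [s]. *)
Lemma multiplicity_unique M (fM : follows M) m (V : vectType K)
    (m' : L -> nat) :
  constituents S (network_rep fM) m -> (0 < \dim {:V})%N ->
  (forall (f : 'Hom({ffun 'I_t -> V}, V)) (C : 'I_t -> 'End(V)),
     (forall X, f X = \sum_s C s (X s)) ->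
     end_trace (admissible_lin M f) =
     \sum_l (m' l)%:R * end_trace (rep_block (S l) C)) ->
  m' =1 m.
Proof.
move=> cM V0 tr'; apply: (character_inj irrS nisoS) => s.
pose C s' : 'End(V) := if s' == s then \1%VF else 0.
have fC X : linfun (ffun_eval s) X = \sum_s' C s' (X s').
  rewrite lfunE (bigD1 s) //= big1 => [|s' /negPf];
    rewrite /C ?eqxx ?addr0 ?lfunE // => ->.
  by rewrite lfunE.
have trC n (X : 'I_t -> 'M[K]_n) :
    end_trace (rep_block X C) = \tr (X s) * (\dim {:V})%:R.
  rewrite end_trace_rep_block (bigD1 s) //= big1 => [|s' /negPf ne].
    by rewrite /C eqxx addr0 end_trace_id.
  rewrite /C ne /end_trace /mx_of_end.
  have -> : passmx.mxof (vbasis {:V}) (vbasis {:V}) 0 = 0.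
    by apply/eqP; rewrite passmx.mxof_eq0 ?vbasisP.
  by rewrite mxtrace0 mulr0.
have dV : (\dim {:V})%:R != 0 :> K by rewrite pnatr_eq0 -lt0n.
apply: (mulIf dV); rewrite !mulr_suml.
have := tr' _ _ fC; rewrite (end_trace_admissible cM fC) => e.
transitivity (\sum_l (m' l)%:R * end_trace (rep_block (S l) C)).
  by apply: eq_bigr => l _; rewrite trC mulrA.
by rewrite -e; apply: eq_bigr => l _; rewrite trC mulrA.
Qed.

End NetworkClass.

Lemma complete_follows t (N : network t) :
  complete N -> exists one mul, follows one mul N.
Proof.
case=> -[one N1] NM; have [mul mulP] := choice (fun cd => NM cd.1 cd.2).
by exists one, (fun c d => mul (c, d)); split=> // c d; exact: (mulP (c, d)).
Qed.

Theorem theorem1p2 (R : realType) (t : nat) (N : network t)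
    (N_complete : complete N) :
  exists (cls : network t -> Prop) (k : nat) (n : 'I_k.+1 -> nat)
         (Lam : forall l : 'I_k.+1, 'I_(n l) -> 'I_(n l) -> 'rV[R[i]]_t),
  (forall l, (1 <= n l)%N) /\
  (* 1 *)
  ((forall M, cls M -> complete M) /\
   cls N /\
   (forall (M : network t) (A : {set M}) (stA : stable A), cls M -> cls (subnetwork stA)) /\
   (forall M P, cls M -> quotient_of P M -> cls P) /\
   (forall M P, cls M -> cls P -> cls (disjoint_union M P))) /\
  (* 2 *)
  (free [seq Lam (tag u) (tagged u).1 (tagged u).2
        | u : {l : 'I_k.+1 & ('I_(n l) * 'I_(n l))%type}] /\
   (\sum_l n l ^ 2 <= t)%N) /\
  (* 3 *)
  (n ord0 = 1%N /\
   forall i j : 'I_(n ord0), Lam ord0 i j = \row_s 1) /\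
  exists m : network t -> 'I_k.+1 -> nat,
  (* 4 *)
  (forall M, cls M ->
     (forall (V : vectType R[i]) (f : 'Hom({ffun 'I_t -> V}, V))
             (C : 'I_t -> 'End(V)),
        (forall X, f X = \sum_s C s (X s)) ->
        (forall lambda : R[i],
           alg_mult lambda (admissible_lin M f)
           = (\sum_l m M l * alg_mult lambda (eval_block (Lam l) C))%N) /\
        end_trace (admissible_lin M f)
        = \sum_l (m M l)%:R * end_trace (eval_block (Lam l) C)) /\
     (forall V : vectType R[i], (0 < \dim {:V})%N ->
      forall m' : 'I_k.+1 -> nat,
        (forall (f : 'Hom({ffun 'I_t -> V}, V)) (C : 'I_t -> 'End(V)),
           (forall X, f X = \sum_s C s (X s)) ->
           end_trace (admissible_lin M f)
           = \sum_l (m' l)%:R * end_trace (eval_block (Lam l) C)) ->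
        m' =1 m M)) /\
  (* 5 *)
  (forall M, cls M ->
     ((0 < #|M|)%N ->
        (\sum_l m M l * n l)%N = #|M| /\ (1 <= m M ord0)%N) /\
     (forall P, quotient_of P M -> forall l, (m P l <= m M l)%N)).
Proof.
have [one [mul fN]] := complete_follows N_complete.
have [k [S [S0 irrS nisoS completeS]]] := complete_family R[i] one mul.
have /choice[m cm] : forall M, exists m : 'I_k.+1 -> nat,
    forall fM : follows one mul M, constituents S (network_rep R[i] fM) m.
  move=> M; case: (pselect (follows one mul M)) => [fM|nfM]; last first.
    by exists (fun=> 0%N) => fM; case: nfM.
  have [mM cM] := constituents_exist completeS (network_rep R[i] fM).
  by exists mM.
exists (follows one mul), k, (fun l => rdim (S l)), (fun l => coef (l := l)).
split; first by move=> l; exact: (irrS l).1.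
split.
  split; first exact: follows_complete.
  split=> //.
  split; first by move=> M A stA; exact: follows_subnetwork.
  split; first exact: follows_quotient.
  exact: follows_disjoint_union.
split.
  split; [exact: coef_free irrS nisoS | exact: sum_rdim_sqr_le irrS nisoS].
split.
  split; first by rewrite S0.
  rewrite /coef S0 => i j; apply/rowP => s.
  by rewrite !mxE !ord1.
exists m; split=> M fM; split.
- move=> V f C fC; split=> [lambda|].
    exact: alg_mult_admissible (cm M fM) fC.
  exact: end_trace_admissible (cm M fM) fC.
- move=> V V0 m' tr'.
  exact: (multiplicity_unique irrS nisoS (cm M fM) V0 tr').
- move=> M0; split; first exact: constituents_dim (cm M fM).
  exact: (network_triv irrS nisoS completeS S0 M0 (cm M fM)).
move=> P PM.
have fP := follows_quotient fM PM.
exact: (network_quotient_le irrS nisoS completeS PM (cm M fM) (cm P fP)).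
Qed.
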